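(* Let $\mathcal{D}$ be a triangulated category with a presilting subcategory $\mathcal{P}$ such that $\mathcal{P}$ is contravariantly finite in $\mathcal{D}$, there is an integer $m<0$ with $\operatorname{Hom}(\mathcal{P},\mathcal{P}[i])=0$ for all $i<m$, and $(\mathcal{D}^{\le 0}_{\mathcal{P}},\mathcal{D}^{\ge 0}_{\mathcal{P}})$ is a non-degenerate $t$-structure on $\mathcal{D}$. Let $d$ be a positive integer, let $\mathcal{K}=\operatorname{thick}(\mathcal{P})$ and $d\text{-}\mathcal{H}=\mathcal{D}^{[-d+1,0]}$. Then the assignment $\mathcal{S}\mapsto \operatorname{add} H^{[-d+1,0]}(\mathcal{S})$ is a bijection from the set of $(d+1)$-term silting subcategories of $\mathcal{K}$ that are contravariantly finite in $\mathcal{D}$ to the set of AIR tilting subcategories of $d\text{-}\mathcal{H}$.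
   Context: Conventions: $[1]$ is the shift functor of a triangulated category. For a class $\mathcal{X}$ of objects in an additive category, $\operatorname{add}\mathcal{X}$ is the full subcategory of direct summands of finite direct sums of objects of $\mathcal{X}$. A subcategory $\mathcal{X}\subseteq\mathcal{C}$ of an additive category always means a full subcategory with $\mathcal{X}=\operatorname{add}\mathcal{X}$. $\operatorname{Hom}(\mathcal{X},\mathcal{Y})=0$ means $\operatorname{Hom}(X,Y)=0$ for all $X\in\mathcal{X}$, $Y\in\mathcal{Y}$. A morphism $f:X\to Y$ is a right $\mathcal{X}$-approximation of $Y$ if $X\in\mathcal{X}$ and every morphism $X'\to Y$ with $X'\in\mathcal{X}$ factors through $f$; $\mathcal{X}$ is contravariantly finite in $\mathcal{C}$ if every object of $\mathcal{C}$ has a right $\mathcal{X}$-approximation. For a subcategory $\mathcal{X}$ of $\mathcal{D}$: $\mathcal{D}^{\le 0}_{\mathcal{X}}=\{Y\in\mathcal{D}\mid \operatorname{Hom}(\mathcal{X},Y[i])=0\ \forall i>0\}$ and $\mathcal{D}^{\ge 0}_{\mathcal{X}}=\{Y\in\mathcal{D}\mid \operatorname{Hom}(\mathcal{X},Y[i])=0\ \forall i<0\}$. $\mathcal{X}*\mathcal{Y}$ is the full subcategory of objects $Z$ admitting a triangle $X\to Z\to Y\to X[1]$ with $X\in\mathcal{X}$, $Y\in\mathcal{Y}$. A subcategory $\mathcal{S}$ of a triangulated category is presilting if $\operatorname{Hom}(\mathcal{S},\mathcal{S}[i])=0$ for all $i>0$; it is silting if moreover the smallest triangulated subcategory containing $\mathcal{S}$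 is the whole category. $\operatorname{thick}(\mathcal{P})$ is the smallest triangulated subcategory of $\mathcal{D}$ closed under direct summands and containing $\mathcal{P}$ (then $\mathcal{P}$ is a silting subcategory of $\mathcal{K}$). Write $\mathcal{D}^{\le q}=\mathcal{D}^{\le 0}_{\mathcal{P}}[-q]$, $\mathcal{D}^{\ge q}=\mathcal{D}^{\ge 0}_{\mathcal{P}}[-q]$, $\mathcal{D}^{[p,q]}=\mathcal{D}^{\le q}\cap\mathcal{D}^{\ge p}$, and $H^{[p,q]}=\sigma^{\ge p}\circ\sigma^{\le q}:\mathcal{D}\to\mathcal{D}^{[p,q]}$, where $\sigma^{\le q}$, $\sigma^{\ge p}$ are the truncation functors of the $t$-structure $(\mathcal{D}^{\le 0}_{\mathcal{P}},\mathcal{D}^{\ge 0}_{\mathcal{P}})$. Put $\mathcal{P}^{[0,d]}=\mathcal{P}*\mathcal{P}[1]*\cdots*\mathcal{P}[d]$. A subcategory $\mathcal{S}$ of $\mathcal{K}$ is $(d+1)$-term if $\mathcal{S}\subseteq\mathcal{P}^{[0,d]}$. An extriangle in $d\text{-}\mathcal{H}$ is a sequence $N\to L\to M$ with $N,L,M\in d\text{-}\mathcal{H}$ that is part of a triangle $N\to L\to M\to N[1]$ in $\mathcal{D}$. For a full subcategory $\mathcal{X}$ of $d\text{-}\mathcal{H}$ and $s\ge1$, $\operatorname{Fac}_s(\mathcal{X})$ is the full subcategory of objects $Z_0\in d\text{-}\mathcal{H}$ for which there are extriangles $Z_i\to X_i\to Z_{i-1}$ in $d\text{-}\mathcal{H}$,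 $1\le i\le s$, with $X_1,\dots,X_s\in\mathcal{X}$. For a $(d+1)$-term subcategory $\mathcal{S}$ of $\mathcal{K}$, $\mathcal{T}(\mathcal{S})=\{X\in d\text{-}\mathcal{H}\mid\operatorname{Hom}(\mathcal{S},X[i])=0\ \forall i>0\}$. A $\mathcal{P}$-presentation of a subcategory $\mathcal{M}\subseteq d\text{-}\mathcal{H}$ is a $(d+1)$-term subcategory $\mathcal{S}$ of $\mathcal{K}$ with $\operatorname{add}H^{[-d+1,0]}(\mathcal{S})=\mathcal{M}$, where $H^{[-d+1,0]}(\mathcal{S})=\{H^{[-d+1,0]}(S)\mid S\in\mathcal{S}\}$. A subcategory $\mathcal{M}$ of $d\text{-}\mathcal{H}$ is AIR tilting with respect to its $\mathcal{P}$-presentation $\mathcal{S}$ if $\mathcal{S}$ is contravariantly finite in $\mathcal{D}$ and $\mathcal{T}(\mathcal{S})=\operatorname{Fac}_d(\mathcal{M})$; $\mathcal{M}$ is AIR tilting if it is so with respect to some $\mathcal{P}$-presentation. *)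

(* Defs.v *)
From HB Require Import structures.
From mathcomp Require Import all_boot all_order all_algebra.
From mathcomp Require Import boolp classical_sets functions.

Set Implicit Arguments.
Unset Strict Implicit.
Unset Printing Implicit Defensive.

Import Order.TTheory GRing.Theory Num.Theory.
Local Open Scope classical_set_scope.
Local Open Scope ring_scope.

HB.mixin Record isPreadditive C := {
  Mor : C -> C -> zmodType;
  idm : forall X : C, Mor X X;
  mcomp : forall X Y Z : C, Mor Y Z -> Mor X Y -> Mor X Z;
  mcompA : forall (X Y Z W : C) (h : Mor Z W) (g : Mor Y Z) (f : Mor X Y),
    mcomp _ _ _ h (mcomp _ _ _ g f) = mcomp _ _ _ (mcomp _ _ _ h g) f;
  mcomp1m : forall (X Y : C) (f : Mor X Y), mcomp _ _ _ (idm Y) f = f;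
  mcompm1 : forall (X Y : C) (f : Mor X Y), mcomp _ _ _ f (idm X) = f;
  mcompDl : forall (X Y Z : C) (g g' : Mor Y Z) (f : Mor X Y),
    mcomp _ _ _ (g + g') f = mcomp _ _ _ g f + mcomp _ _ _ g' f;
  mcompDr : forall (X Y Z : C) (g : Mor Y Z) (f f' : Mor X Y),
    mcomp _ _ _ g (f + f') = mcomp _ _ _ g f + mcomp _ _ _ g f'
}.

#[short(type="preaddCatType")]
HB.structure Definition Preadditive := {C of isPreadditive C}.

Arguments idm {s} X.
Arguments mcomp {s X Y Z} g f.

Declare Scope cat_scope.
Delimit Scope cat_scope with cat.
Notation "g ∘ f" := (mcomp g f)
  (at level 40, left associativity) : cat_scope.
Local Open Scope cat_scope.

Section PreadditiveTheory.
Variable C : preaddCatType.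
Implicit Types X Y Z : C.

Definition is_iso X Y (f : Mor X Y) : Prop :=
  exists g : Mor Y X, g ∘ f = idm X /\ f ∘ g = idm Y.

Definition iso X Y : Prop := exists f : Mor X Y, is_iso f.

Definition is_zero Z : Prop :=
  forall X, (forall f : Mor X Z, f = 0) /\ (forall f : Mor Z X, f = 0).

Definition is_biproduct X Y Z : Prop :=
  exists (i1 : Mor X Z) (i2 : Mor Y Z) (p1 : Mor Z X) (p2 : Mor Z Y),
    [/\ p1 ∘ i1 = idm X, p2 ∘ i2 = idm Y, p1 ∘ i2 = 0, p2 ∘ i1 = 0
      & i1 ∘ p1 + i2 ∘ p2 = idm Z].

(** For [n = 0] this says that [Z] is a zero object. *)
Definition is_direct_sum n (F : 'I_n -> C) Z : Prop :=
  exists (i : forall k, Mor (F k) Z) (p : forall k, Mor Z (F k)),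
    [/\ forall k, p k ∘ i k = idm (F k),
        forall j k, j != k -> p j ∘ i k = 0
      & \sum_(k < n) i k ∘ p k = idm Z].

Definition is_summand X Z : Prop := exists Y, is_biproduct X Y Z.

(** A full subcategory is given by its set of objects. *)
Definition add (A : set C) : set C :=
  [set X | exists n (F : 'I_n -> C) Z,
     [/\ forall k, A (F k), is_direct_sum F Z & is_summand X Z]].

Definition subcategory (A : set C) : Prop := add A = A.

Definition hom_vanish (A B : set C) : Prop :=
  forall X Y, A X -> B Y -> forall f : Mor X Y, f = 0.

Definition right_approx (A : set C) X Y (f : Mor X Y) : Prop :=
  A X /\ forall X' (g : Mor X' Y), A X' -> exists h : Mor X' X, g = f ∘ h.

Definition contravariantly_finite (A : set C) : Prop :=
  forall Y, exists X (f : Mor X Y), right_approx A f.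

End PreadditiveTheory.

HB.mixin Record isAdditive C of Preadditive C := {
  zero_ob : C;
  zero_obP : is_zero zero_ob;
  biproduct_ex : forall X Y : C, exists Z, is_biproduct X Y Z
}.

#[short(type="addCatType")]
HB.structure Definition Additive := {C of isPreadditive C & isAdditive C}.

Arguments zero_ob {s}.

Record addFunctor (C D : preaddCatType) := AddFunctor {
  fob :> C -> D;
  fmap : forall X Y, Mor X Y -> Mor (fob X) (fob Y);
  fmap1 : forall X, fmap (idm X) = idm (fob X);
  fmapM : forall X Y Z (g : Mor Y Z) (f : Mor X Y),
    fmap (g ∘ f) = fmap g ∘ fmap f;
  fmapD : forall X Y (f g : Mor X Y), fmap (f + g) = fmap f + fmap g
}.

Arguments fmap {C D} F {X Y} f : rename.

(** [G \o F] is naturally isomorphic to the identity functor. *)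
Definition nat_iso_id (C D : preaddCatType)
    (F : addFunctor C D) (G : addFunctor D C) : Prop :=
  exists eta : forall X : C, Mor X (G (F X)),
    (forall X, is_iso (eta X)) /\
    (forall X Y (f : Mor X Y), fmap G (fmap F f) ∘ eta X = eta Y ∘ f).

(** The shift [sh] is an autoequivalence with quasi-inverse [shV], which need
    not be a strict inverse. *)
HB.mixin Record isTriangulated C of Additive C := {
  sh : addFunctor C C;
  shV : addFunctor C C;
  shK : nat_iso_id sh shV;
  shVK : nat_iso_id shV sh;
  triangle : forall X Y Z : C, Mor X Y -> Mor Y Z -> Mor Z (sh X) -> Prop;
  (* TR1 *)
  triangle_iso : forall (X Y Z X' Y' Z' : C)
      (f : Mor X Y) (g : Mor Y Z) (h : Mor Z (sh X))
      (f' : Mor X' Y') (g' : Mor Y' Z') (h' : Mor Z' (sh X'))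
      (a : Mor X X') (b : Mor Y Y') (c : Mor Z Z'),
    is_iso a -> is_iso b -> is_iso c ->
    b ∘ f = f' ∘ a -> c ∘ g = g' ∘ b -> fmap sh a ∘ h = h' ∘ c ->
    triangle _ _ _ f g h -> triangle _ _ _ f' g' h';
  triangle_id : forall X : C,
    triangle _ _ _ (idm X) (0 : Mor X zero_ob) (0 : Mor zero_ob (sh X));
  triangle_ex : forall (X Y : C) (f : Mor X Y),
    exists Z (g : Mor Y Z) (h : Mor Z (sh X)), triangle _ _ _ f g h;
  (* TR2 *)
  triangle_rot : forall (X Y Z : C)
      (f : Mor X Y) (g : Mor Y Z) (h : Mor Z (sh X)),
    triangle _ _ _ f g h <-> triangle _ _ _ g h (- fmap sh f);
  (* TR3 *)
  triangle_fill : forall (X Y Z X' Y' Z' : C)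
      (f : Mor X Y) (g : Mor Y Z) (h : Mor Z (sh X))
      (f' : Mor X' Y') (g' : Mor Y' Z') (h' : Mor Z' (sh X'))
      (a : Mor X X') (b : Mor Y Y'),
    triangle _ _ _ f g h -> triangle _ _ _ f' g' h' -> b ∘ f = f' ∘ a ->
    exists c : Mor Z Z', c ∘ g = g' ∘ b /\ fmap sh a ∘ h = h' ∘ c;
  (* TR4 *)
  triangle_oct : forall (X Y Z X' Y' Z' : C) (f : Mor X Y) (g : Mor Y Z)
      (u : Mor Y Z') (v : Mor Z' (sh X))
      (s : Mor Z X') (t : Mor X' (sh Y))
      (p : Mor Z Y') (q : Mor Y' (sh X)),
    triangle _ _ _ f u v -> triangle _ _ _ g s t -> triangle _ _ _ (g ∘ f) p q ->
    exists (a : Mor Z' Y') (b : Mor Y' X'),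
      [/\ triangle _ _ _ a b (fmap sh u ∘ t),
          p ∘ g = a ∘ u, q ∘ a = v, b ∘ p = s & t ∘ b = fmap sh f ∘ q]
}.

#[short(type="triangCatType")]
HB.structure Definition Triangulated :=
  {C of isPreadditive C & isAdditive C & isTriangulated C}.

Arguments triangle {s X Y Z} _ _ _.

Section TriangulatedTheory.
Variable D : triangCatType.
Implicit Types (X Y Z : D) (A B : set D).

Definition shift (n : int) X : D :=
  match n with
  | Posz k => iter k (sh : D -> D) X
  | Negz k => iter k.+1 (shV : D -> D) X
  end.

(** [A[n]], closed under isomorphism since [shV] inverts [sh] only up to
    isomorphism. *)
Definition shift_sub (n : int) A : set D :=
  [set Y | exists2 X, A X & iso Y (shift n X)].

Definition star A B : set D :=
  [set Z | exists X Y (f : Mor X Z) (g : Mor Z Y) (h : Mor Y (sh X)),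
     [/\ A X, B Y & triangle f g h]].

(** Closure under isomorphism follows from closure under cones. *)
Definition triangulated_sub A : Prop :=
  [/\ A zero_ob,
      forall X, A X -> A (sh X) /\ A (shV X)
    & forall X Y Z (f : Mor X Y) (g : Mor Y Z) (h : Mor Z (sh X)),
        triangle f g h -> A X -> A Y -> A Z].

Definition thick_sub A : Prop :=
  triangulated_sub A /\ forall X Y, is_summand X Y -> A Y -> A X.

Definition tri A : set D := smallest triangulated_sub A.
Definition thick A : set D := smallest thick_sub A.

Definition presilting A : Prop :=
  forall i : int, 0 < i -> hom_vanish A (shift_sub i A).

(** [S] is a silting subcategory of the triangulated subcategory [K]. *)
Definition silting (K S : set D) : Prop :=
  [/\ S `<=` K, subcategory S, presilting S & tri S = K].

Definition is_tstructure (U V : set D) : Prop :=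
  [/\ hom_vanish U (shift_sub (-1) V),
      shift_sub 1 U `<=` U,
      shift_sub (-1) V `<=` V
    & forall X, star U (shift_sub (-1) V) X].

Definition nondegenerate_tstructure (U V : set D) : Prop :=
  (forall X, (forall n : int, shift_sub n U X) -> is_zero X) /\
  (forall X, (forall n : int, shift_sub n V X) -> is_zero X).

Section Truncation.
Variables (U V : set D) (tUV : is_tstructure U V).

Lemma truncation_ex X : exists AB : D * D,
  [/\ U AB.1, shift_sub (-1) V AB.2
    & exists (f : Mor AB.1 X) (g : Mor X AB.2) (h : Mor AB.2 (sh AB.1)),
        triangle f g h].
Proof.
case: tUV => _ _ _ /(_ X) [A [B [f [g [h [UA VB T]]]]]].
by exists (A, B); split=> //; exists f, g, h.
Qed.

(** The truncation functors on objects: a choice of the outer terms of the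
    triangle [σ^{≤0} X -> X -> σ^{≥1} X -> (σ^{≤0} X)[1]], which are unique up
    to isomorphism. *)
Definition trunc_le0 X : D := (sval (cid (truncation_ex X))).1.
Definition trunc_ge1 X : D := (sval (cid (truncation_ex X))).2.

(** [σ^{≤q} X = (σ^{≤0} (X[q]))[-q]] and [σ^{≥p} X = (σ^{≥1} (X[p-1]))[1-p]] *)
Definition trunc_le (q : int) X : D := shift (- q) (trunc_le0 (shift q X)).
Definition trunc_ge (p : int) X : D :=
  shift (1 - p) (trunc_ge1 (shift (p - 1) X)).

Definition coh (p q : int) X : D := trunc_ge p (trunc_le q X).

End Truncation.

Definition Dle0 A : set D :=
  [set Y | forall i : int, 0 < i -> forall X, A X ->
     forall f : Mor X (shift i Y), f = 0].
Definition Dge0 A : set D :=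
  [set Y | forall i : int, i < 0 -> forall X, A X ->
     forall f : Mor X (shift i Y), f = 0].

Definition Dle A (q : int) : set D := shift_sub (- q) (Dle0 A).
Definition Dge A (q : int) : set D := shift_sub (- q) (Dge0 A).
Definition Dint A (p q : int) : set D := Dle A q `&` Dge A p.

Section ExtendedHeart.
Variables (P : set D) (d : nat).

(** [d-H] *)
Definition ext_heart : set D := Dint P (1 - d%:Z) 0.

(** [P * P[1] * ... * P[n]] *)
Fixpoint Pterm (n : nat) : set D :=
  match n with
  | 0%N => P
  | k.+1 => star (Pterm k) (shift_sub k.+1%:Z P)
  end.

Definition term_subcategory (S : set D) : Prop :=
  [/\ subcategory S, S `<=` thick P & S `<=` Pterm d].

Definition extriangle N L M : Prop :=
  [/\ ext_heart N, ext_heart L, ext_heart M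
    & exists (f : Mor N L) (g : Mor L M) (h : Mor M (sh N)), triangle f g h].

Definition Fac (s : nat) (A : set D) : set D :=
  [set Z0 | ext_heart Z0 /\ exists Z X : nat -> D, Z 0%N = Z0 /\
     forall i, (1 <= i <= s)%N -> A (X i) /\ extriangle (Z i) (X i) (Z i.-1)].

Definition torsion (S : set D) : set D :=
  [set X | ext_heart X /\ forall i : int, 0 < i ->
     forall Y, S Y -> forall f : Mor Y (shift i X), f = 0].

Variable tP : is_tstructure (Dle0 P) (Dge0 P).

(** [add H^{[-d+1,0]}(S)]. Direct sums and summands are taken in [D], which is
    the same as in [d-H], as [d-H] is closed under both. *)
Definition addH (S : set D) : set D := add (coh tP (1 - d%:Z) 0 @` S).

Definition presentation (M S : set D) : Prop :=
  term_subcategory S /\ addH S = M.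

Definition AIR_tilting_wrt (M S : set D) : Prop :=
  [/\ presentation M S, contravariantly_finite S & torsion S = Fac d M].

Definition AIR_tilting (M : set D) : Prop :=
  [/\ subcategory M, M `<=` ext_heart & exists S, AIR_tilting_wrt M S].

End ExtendedHeart.

End TriangulatedTheory.

(* Main.v *)
Require Import Defs.
From mathcomp Require Import all_boot all_order all_algebra.
From mathcomp Require Import boolp classical_sets functions.
From mathcomp Require Import zify.

Set Implicit Arguments.
Unset Strict Implicit.
Unset Printing Implicit Defensive.

Import Order.TTheory GRing.Theory Num.Theory.

Local Open Scope classical_set_scope.
Local Open Scope ring_scope.
Local Open Scope cat_scope.

(** Write D_S for the aisle {Y | Hom(S, Y[i]) = 0 for all i > 0}. For a silting
    (d+1)-term S one has D_P[d] ⊆ D_S ⊆ D_P, hence D_S consists of the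
    extensions of objects of T(S) by objects of D_P[d], and T(S) determines D_S,
    which in turn determines S: an object of S splits off its approximation by
    any other silting subcategory with the same aisle. Approximating an object of
    T(S) by S and truncating gives an extriangle with kernel in T(S), so that
    T(S) = Fac_d(M) for M = add H(S).

    Conversely, if T(S) = Fac_d(M) then M ⊆ T(S), which forces S to be
    presilting; and since every object of T(S) is a quotient of an object of M,
    the class D_S ∩ D_P is closed under cocones of right S-approximations.
    Iterating these approximations resolves any object of thick(P), up to shift,
    by finitely many objects of S, so S generates thick(P). *)

Arguments mcompA {s X Y Z W} h g f.
Arguments mcomp1m {s X Y} f.
Arguments mcompm1 {s X Y} f.
Arguments mcompDl {s X Y Z} g g' f.
Arguments mcompDr {s X Y Z} g f f'.

(** * Preadditive categories: isomorphisms, retracts and finite sums *)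

Section PreadditiveLemmas.
Variable C : preaddCatType.
Implicit Types X Y Z : C.

Lemma comp0m X Y Z (f : Mor X Y) : (0 : Mor Y Z) ∘ f = 0.
Proof. by apply: (addrI (0 ∘ f)); rewrite -mcompDl !addr0. Qed.

Lemma compm0 X Y Z (g : Mor Y Z) : g ∘ (0 : Mor X Y) = 0.
Proof. by apply: (addrI (g ∘ 0)); rewrite -mcompDr !addr0. Qed.

Lemma compNm X Y Z (g : Mor Y Z) (f : Mor X Y) : (- g) ∘ f = - (g ∘ f).
Proof. by apply: (addrI (g ∘ f)); rewrite -mcompDl !subrr comp0m. Qed.

Lemma compmN X Y Z (g : Mor Y Z) (f : Mor X Y) : g ∘ (- f) = - (g ∘ f).
Proof. by apply: (addrI (g ∘ f)); rewrite -mcompDr !subrr compm0. Qed.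

Lemma compBm X Y Z (g g' : Mor Y Z) (f : Mor X Y) :
  (g - g') ∘ f = g ∘ f - g' ∘ f.
Proof. by rewrite mcompDl compNm. Qed.

Lemma compmB X Y Z (g : Mor Y Z) (f f' : Mor X Y) :
  g ∘ (f - f') = g ∘ f - g ∘ f'.
Proof. by rewrite mcompDr compmN. Qed.

Lemma comp_suml X Y Z (I : finType) (g : I -> Mor Y Z) (f : Mor X Y) :
  (\sum_k g k) ∘ f = \sum_k g k ∘ f.
Proof.
by apply: (big_morph (fun h => h ∘ f)) => [g1 g2|]; rewrite (mcompDl, comp0m).
Qed.

Lemma comp_sumr X Y Z (I : finType) (g : Mor Y Z) (f : I -> Mor X Y) :
  g ∘ (\sum_k f k) = \sum_k g ∘ f k.
Proof.
by apply: (big_morph (fun h => g ∘ h)) => [f1 f2|]; rewrite (mcompDr, compm0).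
Qed.

Lemma iso_refl X : iso X X.
Proof. by exists (idm X), (idm X); rewrite mcomp1m. Qed.

Lemma iso_sym X Y : iso X Y -> iso Y X.
Proof. by case=> f [g [fK gK]]; exists g, f. Qed.

Lemma iso_trans Y X Z : iso X Y -> iso Y Z -> iso X Z.
Proof.
case=> f [f' [fK f'K]] [g [g' [gK g'K]]]; exists (g ∘ f), (f' ∘ g'); split.
  by rewrite mcompA -(mcompA f') gK mcompm1.
by rewrite mcompA -(mcompA g) f'K mcompm1.
Qed.

Definition hom0 X Y : Prop := forall f : Mor X Y, f = 0.

Definition retract X Z : Prop :=
  exists (i : Mor X Z) (r : Mor Z X), r ∘ i = idm X.

Lemma iso_retract X Y : iso X Y -> retract X Y.
Proof. by case=> f [g [fK _]]; exists f, g. Qed.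

Lemma retract_hom0l X X' Y : retract X' X -> hom0 X Y -> hom0 X' Y.
Proof.
by case=> i [r ri] XY f; rewrite -(mcompm1 f) -ri mcompA (XY (f ∘ r)) comp0m.
Qed.

Lemma retract_hom0r X Y Y' : retract Y' Y -> hom0 X Y -> hom0 X Y'.
Proof.
by case=> i [r ri] XY f; rewrite -(mcomp1m f) -ri -mcompA (XY (i ∘ f)) compm0.
Qed.

Lemma iso_hom0 X X' Y Y' : iso X X' -> iso Y Y' -> hom0 X Y -> hom0 X' Y'.
Proof.
move=> /iso_sym/iso_retract XX' /iso_sym/iso_retract YY' XY.
exact/(retract_hom0l XX')/(retract_hom0r YY').
Qed.

Lemma is_zeroP Z : is_zero Z <-> idm Z = 0.
Proof.
split=> [/(_ Z) [+ _]|Z0 X]; first exact.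
by split=> f; [rewrite -(mcomp1m f) Z0 comp0m | rewrite -(mcompm1 f) Z0 compm0].
Qed.

Lemma is_zero_iso X Y : is_zero X -> is_zero Y -> iso X Y.
Proof.
by move=> /is_zeroP X0 /is_zeroP Y0; exists 0, 0; rewrite comp0m compm0 X0 Y0.
Qed.

Lemma summand_retract X Z : is_summand X Z -> retract X Z.
Proof. by case=> Y [i [? [r [? [? _ _ _ _]]]]]; exists i, r. Qed.

(** In a triangulated category this is membership of the identity in the ideal
    of morphisms factoring through finite direct sums of objects of [A]. *)
Definition add_id (A : set C) X : Prop :=
  exists n (F : 'I_n -> C) (i : forall k, Mor (F k) X)
    (p : forall k, Mor X (F k)),
    (forall k, A (F k)) /\ \sum_(k < n) i k ∘ p k = idm X.

Lemma add_add_id (A : set C) X : Defs.add A X -> add_id A X.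
Proof.
case=> n [F [Z [AF [i [p [_ _ ip]]] /summand_retract [j [r rj]]]]].
exists n, F, (fun k => r ∘ i k), (fun k => p k ∘ j); split=> //.
rewrite -rj -[in RHS](mcompm1 r) -ip comp_sumr comp_suml.
by apply: eq_bigr => k _; rewrite !mcompA.
Qed.

Lemma add_id_hom0r (A : set C) X Y :
  (forall Y', A Y' -> hom0 X Y') -> add_id A Y -> hom0 X Y.
Proof.
move=> AX [n [F [i [p [AF ip]]]]] f; rewrite -(mcomp1m f) -ip comp_suml big1//.
by move=> k _; rewrite -mcompA (AX (F k) (AF k) (_ ∘ f)) ?compm0.
Qed.

Lemma add_id_retract (A : set C) X Y : retract X Y -> add_id A Y -> add_id A X.
Proof.
case=> j [r rj] [n [F [i [p [AF ip]]]]].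
exists n, F, (fun k => r ∘ i k), (fun k => p k ∘ j); split=> //.
rewrite -rj -[in RHS](mcompm1 r) -ip comp_sumr comp_suml.
by apply: eq_bigr => k _; rewrite !mcompA.
Qed.

Section OrdFamily.
Variables (n : nat) (T : 'I_n.+1 -> Type).
Variables (x0 : T ord0) (x : forall j, T (lift ord0 j)).

(** The structure maps of a direct sum have types depending on the index, so the split into head and
    tail transports along the equation given by [unliftP]. *)
Definition ord_family k : T k :=
  match unliftP ord0 k in fintype.unlift_spec _ _ u return T k with
  | UnliftSome j kE => ecast k (T k) (esym kE) (x j)
  | UnliftNone kE => ecast k (T k) (esym kE) x0
  end.

Lemma ord_family0 : ord_family ord0 = x0.
Proof.
rewrite /ord_family; case: unliftP => [j kE|kE]; first by have /eqP := kE.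
by rewrite (eq_irrelevance kE erefl).
Qed.

Lemma ord_familyS j : ord_family (lift ord0 j) = x j.
Proof.
rewrite /ord_family; case: unliftP => [j' kE|kE]; last by have /eqP := kE.
have jE := lift_inj kE; case: _ / jE in kE *.
by rewrite (eq_irrelevance kE erefl).
Qed.

End OrdFamily.

(** With [p] and [i] the structure maps of a direct sum, this is the product of a row and a column
    matrix. *)
Lemma comp_sum_delta n (F : 'I_n -> C) X Y Z (q : forall k, Mor (F k) Y)
    (p : forall k, Mor Z (F k)) (i : forall k, Mor (F k) Z)
    (a : forall k, Mor X (F k)) :
  (forall k, p k ∘ i k = idm (F k)) ->
  (forall j k, j != k -> p j ∘ i k = 0) ->
  (\sum_k q k ∘ p k) ∘ (\sum_k i k ∘ a k) = \sum_k q k ∘ a k.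
Proof.
move=> pi pi0; rewrite comp_suml; apply: eq_bigr => k _.
rewrite comp_sumr (bigD1 k)//= big1 ?addr0 => [|j jk].
  by rewrite mcompA -(mcompA (q k)) pi mcompm1.
by rewrite mcompA -(mcompA (q k)) pi0 1?eq_sym// compm0 comp0m.
Qed.

End PreadditiveLemmas.

Lemma direct_sum_ex (C : addCatType) n (F : 'I_n -> C) :
  exists Z, is_direct_sum F Z.
Proof.
elim: n F => [|n IHn] F.
  exists zero_ob, (fun=> 0), (fun=> 0).
  split; [by case | by move=> ? [] |].
  by rewrite big_ord0; have /is_zeroP -> := @zero_obP C.
have [Z' [i [p [pi pi0 ip]]]] := IHn (fun k => F (lift ord0 k)).
have [Z [j1 [j2 [q1 [q2 [qj1 qj2 qj12 qj21 jq]]]]]] :=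
  biproduct_ex (F ord0) Z'.
exists Z.
exists (ord_family (T := fun k => Mor (F k) Z) j1 (fun k => j2 ∘ i k)).
exists (ord_family (T := fun k => Mor Z (F k)) q1 (fun k => p k ∘ q2)).
split.
- move=> k; case: (unliftP ord0 k) => [k' ->|->]; rewrite ?ord_familyS ?ord_family0//.
  by rewrite mcompA -(mcompA (p k')) qj2 mcompm1 pi.
- move=> j k; case: (unliftP ord0 j) => [j' ->|->];
    case: (unliftP ord0 k) => [k' ->|->] jk; rewrite ?ord_familyS ?ord_family0//.
  + by rewrite mcompA -(mcompA (p j')) qj2 mcompm1 pi0.
  + by rewrite -mcompA qj21 compm0.
  + by rewrite mcompA qj12 comp0m.
rewrite big_ord_recl !ord_family0 -jq; congr (_ + _).
rewrite -[in RHS](mcompm1 j2) -ip comp_sumr comp_suml.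
by apply: eq_bigr => k _; rewrite !ord_familyS !mcompA.
Qed.

(** * The shift: full faithfulness, integer powers, and vanishing of Hom(X, Y[i]) *)

Section TriangulatedLemmas.
Variable D : triangCatType.
Implicit Types (X Y Z : D) (A : set D).

Lemma fmap0 (C C' : preaddCatType) (F : addFunctor C C') (X Y : C) :
  fmap F (0 : Mor X Y) = 0.
Proof. by apply: (addrI (fmap F 0)); rewrite -fmapD !addr0. Qed.

Lemma fmap_iso (C C' : preaddCatType) (F : addFunctor C C') (X Y : C) :
  iso X Y -> iso (F X) (F Y).
Proof.
case=> f [g [fK gK]]; exists (fmap F f), (fmap F g).
by rewrite -!fmapM fK gK !fmap1.
Qed.

Lemma nat_iso_faithful (C C' : preaddCatType) (F : addFunctor C C')
    (G : addFunctor C' C) (X Y : C) (f g : Mor X Y) :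
  nat_iso_id F G -> fmap F f = fmap F g -> f = g.
Proof.
case=> eta [eta_iso eta_nat] fg.
have [eta' [etaK _]] := eta_iso Y.
rewrite -(mcomp1m f) -(mcomp1m g) -etaK -!mcompA.
by rewrite -!eta_nat fg.
Qed.

Lemma sh_inj X Y (f g : Mor X Y) : fmap sh f = fmap sh g -> f = g.
Proof. exact/nat_iso_faithful/shK. Qed.

Lemma shV_inj X Y (f g : Mor X Y) : fmap shV f = fmap shV g -> f = g.
Proof. exact/nat_iso_faithful/shVK. Qed.

(** The preimage is [fmap shV k] conjugated by the unit; faithfulness of [shV] reduces the equality
    to naturality of the unit. *)
Lemma sh_full X Y (k : Mor (sh X) (sh Y)) : exists f, k = fmap sh f.
Proof.
have [eta [eta_iso eta_nat]] := @shK D.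
have [etaX' [etaXK etaXK']] := eta_iso X.
have [etaY' [etaYK etaYK']] := eta_iso Y.
exists (etaY' ∘ fmap shV k ∘ eta X); apply: shV_inj.
rewrite -[RHS]mcompm1 -etaXK' mcompA eta_nat.
by rewrite !mcompA etaYK' mcomp1m -mcompA etaXK' mcompm1.
Qed.

Lemma hom0_sh X Y : hom0 (sh X) (sh Y) <-> hom0 X Y.
Proof.
split=> XY f; first by apply: sh_inj; rewrite (XY (fmap sh f)) fmap0.
by have [g ->] := sh_full f; rewrite (XY g) fmap0.
Qed.

Lemma shKo X : iso (shV (sh X)) X.
Proof.
by have [eta [/(_ X) eta_iso _]] := @shK D; apply/iso_sym; exists (eta X).
Qed.

Lemma shVKo X : iso (sh (shV X)) X.
Proof.
by have [eta [/(_ X) eta_iso _]] := @shVK D; apply/iso_sym; exists (eta X).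
Qed.

Lemma shift_iso n X Y : iso X Y -> iso (shift n X) (shift n Y).
Proof.
case: n => n XY; last by elim: n => [|n IHn] /=; apply: fmap_iso.
by elim: n => [|n IHn] //=; apply: fmap_iso.
Qed.

Lemma shiftS n X : iso (shift (n + 1) X) (sh (shift n X)).
Proof.
case: n => [n|[|n]]; first by rewrite -PoszD addn1; apply: iso_refl.
  exact/iso_sym/shVKo.
have -> : (Negz n.+1 + 1)%R = Negz n by lia.
exact/iso_sym/shVKo.
Qed.

Lemma shiftP n X : iso (shift (n - 1) X) (shV (shift n X)).
Proof.
have := shiftS (n - 1) X; rewrite subrK => /(fmap_iso shV) XY.
apply/iso_sym/(iso_trans XY)/shKo.
Qed.

Lemma shiftD a b X : iso (shift a (shift b X)) (shift (a + b) X).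
Proof.
elim/int_rect: a => [|n IHn|n IHn]; first by rewrite add0r; apply: iso_refl.
  have -> : (n.+1%:Z = n%:Z + 1)%R by lia.
  have -> : (n%:Z + 1 + b = (n%:Z + b) + 1)%R by lia.
  apply: iso_trans (shiftS _ _) _; apply/(iso_trans (fmap_iso sh IHn))/iso_sym.
  exact: shiftS.
have -> : (- n.+1%:Z = - n%:Z - 1)%R by lia.
have -> : (- n%:Z - 1 + b = (- n%:Z + b) - 1)%R by lia.
apply: iso_trans (shiftP _ _) _; apply/(iso_trans (fmap_iso shV IHn))/iso_sym.
exact: shiftP.
Qed.

Lemma shiftK a X : iso (shift (- a) (shift a X)) X.
Proof. by have := shiftD (- a) a X; rewrite addNr. Qed.

Lemma shiftVK a X : iso (shift a (shift (- a) X)) X.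
Proof. by have := shiftD a (- a) X; rewrite addrN. Qed.

Lemma hom0_shift n X Y : hom0 (shift n X) (shift n Y) <-> hom0 X Y.
Proof.
have shn m (U V : D) : hom0 (shift (Posz m) U) (shift (Posz m) V) <-> hom0 U V.
  elim: m => [|m IHm] //.
  by rewrite -IHm; exact: (hom0_sh (shift m U) (shift m V)).
case: n => n; first exact: shn.
rewrite -(shn n.+1); have K (Z : D) := shiftVK n.+1 Z.
by split; apply: iso_hom0; do ?[apply: K|apply/iso_sym/K].
Qed.

Definition ext0 X Y i : Prop := hom0 X (shift i Y).

Lemma ext0_iso X X' Y Y' i : iso X X' -> iso Y Y' -> ext0 X Y i -> ext0 X' Y' i.
Proof. by move=> XX' /(shift_iso i); apply: iso_hom0. Qed.

Lemma ext0_shiftr X Y a i : ext0 X (shift a Y) i <-> ext0 X Y (i + a).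
Proof.
split; apply: iso_hom0; do ?exact: iso_refl; last apply/iso_sym; exact: shiftD.
Qed.

Lemma ext0_shiftl X Y a i : ext0 (shift a X) Y i <-> ext0 X Y (i - a).
Proof.
rewrite /ext0 -(hom0_shift (- a)) [i - a]addrC.
split; apply: iso_hom0;
  first [exact: shiftK | exact: shiftD
        | apply/iso_sym; first [exact: shiftK | exact: shiftD]].
Qed.

Lemma ext0_retractl X X' Y i : retract X' X -> ext0 X Y i -> ext0 X' Y i.
Proof. exact: retract_hom0l. Qed.

(** [shift] is defined on objects only, so retracts and sums in the second argument are handled
    after moving the shift to the first. *)
Lemma ext0E X Y i : ext0 X Y i <-> hom0 (shift (- i) X) Y.
Proof. by have := ext0_shiftl X Y (- i) 0; rewrite sub0r opprK => <-. Qed.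

Lemma ext0_retractr X Y Y' i : retract Y' Y -> ext0 X Y i -> ext0 X Y' i.
Proof. by move=> YY'; rewrite !ext0E; apply: retract_hom0r. Qed.

Lemma add_ext0r A X Y i :
  (forall Y', A Y' -> ext0 X Y' i) -> Defs.add A Y -> ext0 X Y i.
Proof.
move=> AX /add_add_id; rewrite ext0E; apply: add_id_hom0r => Y' /AX.
by rewrite ext0E.
Qed.

End TriangulatedLemmas.

(** * Distinguished triangles: exactness, additive closures, long exact sequences *)

Section Triangles.
Variable D : triangCatType.
Implicit Types (B X Y Z : D) (A : set D).

Lemma triangle_rotl X Y Z (f : Mor X Y) (g : Mor Y Z) (h : Mor Z (sh X)) :
  triangle f g h -> triangle g h (- fmap sh f).
Proof. exact: (proj1 (triangle_rot _ _ _ f g h)). Qed.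

(** Rotating back needs a third term of the form [sh _], so [Z] is replaced by [sh (shV Z)] and
    fullness of the shift desuspends [- h]. *)
Lemma triangle_unrot X Y Z (f : Mor X Y) (g : Mor Y Z) (h : Mor Z (sh X)) :
  triangle f g h ->
  exists (f' : Mor (shV Z) X) (h' : Mor Y (sh (shV Z))), triangle f' f h'.
Proof.
move=> T; have [e [e' [eK e'K]]] := shVKo Z.
have [f0 f0E] := sh_full (- (h ∘ e)).
exists f0, (e' ∘ g); apply/triangle_rot; rewrite -f0E opprK.
apply: (triangle_iso _ _ _ _ _ _ _ _ _ _ _ _ (idm X) (idm Y) e' _ _ _ _ _ _ T).
- by exists (idm X); rewrite mcomp1m.
- by exists (idm Y); rewrite mcomp1m.
- by exists e.
- by rewrite mcomp1m mcompm1.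
- by rewrite mcompm1.
- by rewrite fmap1 mcomp1m -mcompA e'K mcompm1.
Qed.

Lemma cocone_ex Y Z (g : Mor Y Z) :
  exists X (f : Mor X Y) (h : Mor Z (sh X)), triangle f g h.
Proof.
have [C [a [b /triangle_unrot [f [h T]]]]] := triangle_ex _ _ g.
by exists (shV C), f, h.
Qed.

Lemma triangle_comp0 X Y Z (f : Mor X Y) (g : Mor Y Z) (h : Mor Z (sh X)) :
  triangle f g h -> g ∘ f = 0.
Proof.
move=> T; have [|c [c0 _]] :=
  triangle_fill _ _ _ _ _ _ _ _ _ _ _ _ (idm X) f (triangle_id X) T.
  by [].
by rewrite -c0 compm0.
Qed.

(** Map the rotated identity triangle of [B] to the rotated given triangle; the third component of
    the filler desuspends to the lift. *)
Lemma triangle_lift X Y Z (f : Mor X Y) (g : Mor Y Z) (h : Mor Z (sh X))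
    B (u : Mor B Y) :
  triangle f g h -> g ∘ u = 0 -> exists v, u = f ∘ v.
Proof.
move=> T gu0; have [|c [_ cE]] :=
  triangle_fill _ _ _ _ _ _ _ _ _ _ _ _ u 0
    (triangle_rotl (triangle_id B)) (triangle_rotl T).
  by rewrite gu0 comp0m.
have [v vE] := sh_full c; exists v; apply: sh_inj; apply: oppr_inj.
by rewrite fmapM -vE -compNm -cE fmap1 compmN mcompm1.
Qed.

Lemma triangle_0id B : exists h, triangle (0 : Mor zero_ob B) (idm B) h.
Proof.
have [f [h T]] := triangle_unrot (triangle_id B).
have Z0 : is_zero (shV (zero_ob : D)).
  apply/is_zeroP; rewrite -fmap1.
  by have /is_zeroP -> := @zero_obP D; rewrite fmap0.
have [e [e' [eK e'K]]] := is_zero_iso Z0 (@zero_obP D).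
exists (fmap sh e ∘ h).
apply: (triangle_iso _ _ _ _ _ _ _ _ _ _ _ _ e (idm B) (idm B) _ _ _ _ _ _ T).
- by exists e'.
- by exists (idm B); rewrite mcomp1m.
- by exists (idm B); rewrite mcomp1m.
- by rewrite mcomp1m comp0m; have [_] := Z0 B; apply.
- by [].
- by rewrite mcompm1.
Qed.

Lemma triangle_extend X Y Z (f : Mor X Y) (g : Mor Y Z) (h : Mor Z (sh X))
    B (u : Mor Y B) :
  triangle f g h -> u ∘ f = 0 -> exists v, u = v ∘ g.
Proof.
move=> T uf0; have [h' T'] := triangle_0id B.
have [|c [cE _]] := triangle_fill _ _ _ _ _ _ _ _ _ _ _ _ 0 u T T'.
  by rewrite uf0 comp0m.
by exists c; rewrite cE mcomp1m.
Qed.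

Lemma triangle_split X Y Z (f : Mor X Y) (g : Mor Y Z) (h : Mor Z (sh X)) :
  triangle f g h -> h = 0 -> retract Z Y.
Proof.
move=> /triangle_rotl T h0.
have [|s sE] := triangle_lift (u := idm Z) T; first by rewrite h0 comp0m.
by exists s, g.
Qed.

(** The complement is the cone of [i]: the retraction forces the connecting map [h] to vanish, so
    the map to the cone has a section, which [idm Z - i ∘ r] corrects to be killed by [r]. *)
Lemma retract_summand X Z : retract X Z -> is_summand X Z.
Proof.
case=> i [r ri]; have [Y [g [h T]]] := triangle_ex _ _ i; exists Y.
have gi := triangle_comp0 T.
have h0 : h = 0.
  apply: oppr_inj; rewrite oppr0 -(mcomp1m h) -fmap1 -ri fmapM -mcompA.
  by rewrite -compmN -compNm (triangle_comp0 (triangle_rotl (triangle_rotl T)))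
    compm0.
have [|s sE] := triangle_lift (u := idm Y) (triangle_rotl T).
  by rewrite h0 comp0m.
have [|t tE] := triangle_extend (u := idm Z - i ∘ r) T.
  by rewrite compBm mcomp1m -mcompA ri mcompm1 subrr.
have rt : r ∘ (idm Z - i ∘ r) = 0.
  by rewrite compmB mcompm1 mcompA ri mcomp1m subrr.
have gt : g ∘ (idm Z - i ∘ r) = g.
  by rewrite compmB mcompm1 mcompA gi comp0m subr0.
exists i, ((idm Z - i ∘ r) ∘ s), r, g; split=> //.
- by rewrite mcompA gt sE.
- by rewrite mcompA rt comp0m.
have -> : (idm Z - i ∘ r) ∘ s ∘ g = idm Z - i ∘ r.
  by rewrite tE -(mcompA t) -sE mcompm1.
by rewrite addrC subrK.
Qed.

Lemma addP A X : Defs.add A X <-> add_id A X.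
Proof.
split; first exact: add_add_id.
case=> n [F [i [p [AF ip]]]].
have [Z FZ] := direct_sum_ex F; exists n, F, Z; split=> //.
case: FZ => i' [p' [p'i' p'i'0 _]]; apply: retract_summand.
exists (\sum_k i' k ∘ p k), (\sum_k i k ∘ p' k).
by rewrite comp_sum_delta.
Qed.

Lemma subset_add A : A `<=` Defs.add A.
Proof.
move=> X AX; apply/addP; exists 1%N, (fun=> X), (fun=> idm X), (fun=> idm X).
by rewrite big_ord1 mcomp1m.
Qed.

Lemma add_zero A Z : is_zero Z -> Defs.add A Z.
Proof.
move=> /is_zeroP Z0; apply/addP.
by exists 0%N, (fun=> Z), (fun=> 0), (fun=> 0); split=> [[]//|]; rewrite big_ord0.
Qed.

Lemma add_retract A X Y : retract X Y -> Defs.add A Y -> Defs.add A X.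
Proof. by move=> XY /addP/(add_id_retract XY)/addP. Qed.

(** Lists of factorizations represent the ideal of morphisms factoring through finite sums from [A].
    They concatenate without index arithmetic, which makes idempotence of [add] formal. *)
Record factoring A X Y := Factoring {
  factoring_mid : D;
  factoring_midP : A factoring_mid;
  factoring_out : Mor factoring_mid Y;
  factoring_in : Mor X factoring_mid
}.

Definition factors A X Y (f : Mor X Y) : Prop :=
  exists s : seq (factoring A X Y),
    \sum_(x <- s) factoring_out x ∘ factoring_in x = f.

Lemma factors_sum A X Y n (f : 'I_n -> Mor X Y) :
  (forall k, factors A (f k)) -> factors A (\sum_k f k).
Proof.
move=> Af; apply: big_ind => //; first by exists [::]; rewrite big_nil.
by move=> _ _ [s <-] [t <-]; exists (s ++ t); rewrite big_cat.
Qed.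

Lemma factors_comp A X X' Y Y' (g : Mor Y Y') (f : Mor X Y) (h : Mor X' X) :
  factors A f -> factors A (g ∘ f ∘ h).
Proof.
case=> s <-; elim: s => [|x s [t tE]].
  by exists [::]; rewrite !big_nil compm0 comp0m.
exists (Factoring (factoring_midP x) (g ∘ factoring_out x) (factoring_in x ∘ h) :: t).
by rewrite !big_cons tE mcompDr mcompDl /= !mcompA.
Qed.

Lemma add_factors A X : Defs.add A X <-> factors A (idm X).
Proof.
split=> [/addP [n [F [i [p [AF <-]]]]]|[s sE]].
  apply: factors_sum => k; exists [:: Factoring (AF k) (i k) (p k)].
  by rewrite big_seq1.
apply/addP; exists (size s), (fun k => factoring_mid (tnth (in_tuple s) k)).
exists (fun k => factoring_out (tnth (in_tuple s) k)).
exists (fun k => factoring_in (tnth (in_tuple s) k)).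
split=> [k|]; first exact: factoring_midP.
by rewrite -sE [RHS]big_tnth.
Qed.

Lemma add_idem A : Defs.add (Defs.add A) = Defs.add A.
Proof.
apply/seteqP; split; last exact: subset_add.
move=> X /addP [n [F [i [p [AF ip]]]]]; apply/add_factors.
rewrite -ip; apply: factors_sum => k.
rewrite -(mcompm1 (i k)); apply: factors_comp.
exact/add_factors.
Qed.

(** Most vanishing arguments see only the three objects; forgetting the morphisms also removes the
    signs in rotations and shifts. *)
Definition tri3 X Y Z : Prop :=
  exists (f : Mor X Y) (g : Mor Y Z) (h : Mor Z (sh X)), triangle f g h.

Lemma tri3_iso X Y Z X' Y' Z' :
  iso X X' -> iso Y Y' -> iso Z Z' -> tri3 X Y Z -> tri3 X' Y' Z'.
Proof.
move=> [a [a' [aK a'K]]] [b [b' [bK b'K]]] [c [c' [cK c'K]]] [f [g [h T]]].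
exists (b ∘ f ∘ a'), (c ∘ g ∘ b'), (fmap sh a ∘ h ∘ c').
apply: (triangle_iso _ _ _ _ _ _ _ _ _ _ _ _ a b c _ _ _ _ _ _ T).
- by exists a'.
- by exists b'.
- by exists c'.
- by rewrite -(mcompA _ a') aK mcompm1.
- by rewrite -(mcompA _ b') bK mcompm1.
- by rewrite -(mcompA _ c') cK mcompm1.
Qed.

Lemma tri3_rot X Y Z : tri3 X Y Z -> tri3 Y Z (sh X).
Proof. by case=> f [g [h /triangle_rotl T]]; exists g, h, (- fmap sh f). Qed.

Lemma tri3_unrot X Y Z : tri3 X Y Z -> tri3 (shV Z) X Y.
Proof. by case=> f [g [h /triangle_unrot [f' [h' T]]]]; exists f', f, h'. Qed.

Lemma tri3_shift n X Y Z :
  tri3 X Y Z -> tri3 (shift n X) (shift n Y) (shift n Z).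
Proof.
case: n => n T; last by elim: n => [|n IHn] /=; do 3!apply: tri3_unrot.
by elim: n => [|n IHn] //=; do 3!apply: tri3_rot.
Qed.

Lemma tri3_0id X : tri3 zero_ob X X.
Proof. by have [h T] := triangle_0id X; exists 0, (idm X), h. Qed.

Lemma tri3_zero_iso X Y Z : tri3 X Y Z -> is_zero Z -> iso X Y.
Proof.
move=> [f [g [h T]]] Z0; have [f' [h' T']] := triangle_unrot T.
have f'0 : f' = 0.
  by rewrite -(mcompm1 f') -fmap1; have /is_zeroP -> := Z0; rewrite fmap0 compm0.
have [|v vE] := triangle_extend (u := idm X) T'; first by rewrite f'0 compm0.
have [|s sE] := triangle_lift (u := idm Y) T; first by have [+ _] := Z0 Y; apply.
exists f, s; split=> //.
by rewrite -(mcomp1m (s ∘ f)) vE -mcompA (mcompA f) -sE mcomp1m.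
Qed.

Lemma tri3_hom0r X Y Z B : tri3 X Y Z -> hom0 B X -> hom0 B Z -> hom0 B Y.
Proof.
move=> [f [g [h T]]] BX BZ u.
by have [|v ->] := triangle_lift (u := u) T; [exact: BZ|rewrite (BX v) compm0].
Qed.

Lemma tri3_hom0l X Y Z B : tri3 X Y Z -> hom0 X B -> hom0 Z B -> hom0 Y B.
Proof.
move=> [f [g [h T]]] XB ZB u.
by have [|v ->] := triangle_extend (u := u) T; [exact: XB|rewrite (ZB v) comp0m].
Qed.

Lemma ext0_shr X B i : ext0 B (sh X) i <-> ext0 B X (i + 1).
Proof. exact: (ext0_shiftr B X 1 i). Qed.

Lemma ext0_shVr X B i : ext0 B (shV X) i <-> ext0 B X (i - 1).
Proof. exact: (ext0_shiftr B X (-1) i). Qed.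

Lemma ext0_shl X B i : ext0 (sh X) B i <-> ext0 X B (i - 1).
Proof. exact: (ext0_shiftl X B 1 i). Qed.

Lemma ext0_shVl X B i : ext0 (shV X) B i <-> ext0 X B (i + 1).
Proof. exact: (ext0_shiftl X B (-1) i). Qed.

(** This and the next five lemmas read vanishing off the long exact Hom sequences, in each variable
    and at each vertex. *)
Lemma ext0_mid X Y Z B i :
  tri3 X Y Z -> ext0 B X i -> ext0 B Z i -> ext0 B Y i.
Proof. by move=> /(tri3_shift i); apply: tri3_hom0r. Qed.

Lemma ext0_cone X Y Z B i :
  tri3 X Y Z -> ext0 B Y i -> ext0 B X (i + 1) -> ext0 B Z i.
Proof. by move=> /tri3_rot T BY; rewrite -ext0_shr; apply: ext0_mid T BY. Qed.

Lemma ext0_cocone X Y Z B i :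
  tri3 X Y Z -> ext0 B Y i -> ext0 B Z (i - 1) -> ext0 B X i.
Proof.
by move=> /tri3_unrot T BY; rewrite -ext0_shVr => BZ; apply: ext0_mid T BZ BY.
Qed.

Lemma ext0_midl X Y Z B i :
  tri3 X Y Z -> ext0 X B i -> ext0 Z B i -> ext0 Y B i.
Proof. exact: tri3_hom0l. Qed.

Lemma ext0_conel X Y Z B i :
  tri3 X Y Z -> ext0 Y B i -> ext0 X B (i - 1) -> ext0 Z B i.
Proof. by move=> /tri3_rot T BY; rewrite -ext0_shl; apply: ext0_midl T BY. Qed.

Lemma ext0_coconel X Y Z B i :
  tri3 X Y Z -> ext0 Y B i -> ext0 Z B (i + 1) -> ext0 X B i.
Proof.
by move=> /tri3_unrot T BY; rewrite -ext0_shVl => BZ; apply: ext0_midl T BZ BY.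
Qed.

Lemma ext0_zero B i : ext0 B zero_ob i.
Proof.
rewrite ext0E => f; by have [+ _] := @zero_obP D (shift (- i) B); apply.
Qed.

Lemma ext0_zerol B i : ext0 zero_ob B i.
Proof. by move=> f; have [_] := @zero_obP D (shift i B); apply. Qed.

(** Here the map to Hom(B, X[1]) vanishes by surjectivity of Hom(B, Y) → Hom(B, Z), not because
    Hom(B, Z) vanishes. *)
Lemma triangle_ext1 X Y Z (f : Mor X Y) (g : Mor Y Z) (h : Mor Z (sh X)) B :
  triangle f g h -> (forall u : Mor B Z, exists v, u = g ∘ v) ->
  ext0 B Y 1 -> ext0 B X 1.
Proof.
move=> T lift BY u.
have [|v vE] := triangle_lift (u := u) (triangle_rotl (triangle_rotl T)).
  by rewrite compNm (BY (fmap sh f ∘ u)) oppr0.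
have [w wE] := lift v.
by rewrite vE wE mcompA (triangle_comp0 (triangle_rotl T)) comp0m.
Qed.

Lemma triangle_lift1 X Y Z (f : Mor X Y) (g : Mor Y Z) (h : Mor Z (sh X)) B
    (u : Mor B Z) :
  triangle f g h -> ext0 B X 1 -> exists v, u = g ∘ v.
Proof. by move=> /triangle_rotl T BX; apply: triangle_lift T (BX (h ∘ u)). Qed.

End Triangles.

(** * Aisles of arbitrary classes, thick closures and approximations *)

Section Aisles.
Variable D : triangCatType.
Implicit Types (X Y Z W : D) (A S P : set D).

(** The class D^{≤q} relative to [A], indexed by degree instead of formed as a shift; it serves for
    [P], for [S] and for their union. *)
Definition le_aisle A (q : int) : set D :=
  [set Y | forall X i, A X -> q < i -> ext0 X Y i].

Definition ge_aisle A (q : int) : set D :=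
  [set Y | forall X i, A X -> i < q -> ext0 X Y i].

Lemma Dle0P A Y : Dle0 A Y <-> le_aisle A 0 Y.
Proof.
split=> Y0; first by move=> X i AX i0 f; apply: Y0 i0 _ AX f.
by move=> i i0 X AX; apply: Y0.
Qed.

Lemma shift_sub_Dle0 A n Y : shift_sub n (Dle0 A) Y <-> le_aisle A (- n) Y.
Proof.
split=> [[Z Z0 YZ] X i AX ni|Yn].
  apply: (ext0_iso (iso_refl X) (iso_sym YZ)); rewrite ext0_shiftr.
  by move=> f; apply: Z0 AX f; lia.
exists (shift (- n) Y); last exact/iso_sym/shiftVK.
by move=> i i0 X AX; apply/ext0_shiftr/Yn => //; lia.
Qed.

Lemma shift_sub_Dge0 A n Y : shift_sub n (Dge0 A) Y <-> ge_aisle A (- n) Y.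
Proof.
split=> [[Z Z0 YZ] X i AX ni|Yn].
  apply: (ext0_iso (iso_refl X) (iso_sym YZ)); rewrite ext0_shiftr.
  by move=> f; apply: Z0 AX f; lia.
exists (shift (- n) Y); last exact/iso_sym/shiftVK.
by move=> i i0 X AX; apply/ext0_shiftr/Yn => //; lia.
Qed.

Lemma ext_heartP P d Y :
  ext_heart P d Y <-> le_aisle P 0 Y /\ ge_aisle P (1 - d%:Z) Y.
Proof.
rewrite /ext_heart /Dint /Dle /Dge.
split=> [[/shift_sub_Dle0 + /shift_sub_Dge0]|[? ?]].
  by rewrite !opprK.
by split; [apply/shift_sub_Dle0|apply/shift_sub_Dge0]; rewrite opprK.
Qed.

Lemma torsionP P d S X : torsion P d S X <-> ext_heart P d X /\ le_aisle S 0 X.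
Proof.
split=> -[HX SX]; split=> //.
  by move=> Y i SY i0 f; apply: SX SY f.
by move=> i i0 Y SY f; apply: SX SY i0 f.
Qed.

Lemma presiltingP A : presilting A <-> A `<=` le_aisle A 0.
Proof.
split=> [pA Y AY X i AX i0 f|pA i i0 X Y' AX [Y AY YY'] f].
  by apply: pA i0 _ _ AX _ f; exists Y => //; apply: iso_refl.
by apply: (iso_hom0 (iso_refl X) (iso_sym YY') (pA _ AY X i AX i0)).
Qed.

Lemma le_aisle_shift A n q Y :
  le_aisle A q Y -> le_aisle A (q - n) (shift n Y).
Proof. by move=> Yq X i AX qi; apply/ext0_shiftr/Yq => //; lia. Qed.

Lemma ge_aisle_shift A n q Y :
  ge_aisle A q Y -> ge_aisle A (q - n) (shift n Y).
Proof. by move=> Yq X i AX qi; apply/ext0_shiftr/Yq => //; lia. Qed.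

Lemma le_aisle_iso A q X Y : iso X Y -> le_aisle A q X -> le_aisle A q Y.
Proof. by move=> XY Xq Z i AZ qi; apply: ext0_iso (iso_refl Z) XY (Xq Z i AZ qi). Qed.

Lemma le_aisle_mid A q X Y Z :
  tri3 X Y Z -> le_aisle A q X -> le_aisle A q Z -> le_aisle A q Y.
Proof. by move=> T Xq Zq B i AB qi; apply: ext0_mid T (Xq B i AB qi) (Zq B i AB qi). Qed.

Lemma le_aisle_cone A q X Y Z :
  tri3 X Y Z -> le_aisle A q Y -> le_aisle A (q + 1) X -> le_aisle A q Z.
Proof.
move=> T Yq Xq B i AB qi; apply: ext0_cone T (Yq B i AB qi) (Xq B _ AB _); lia.
Qed.

(** Used to shift an object of thick(P) into the aisles of both [S] and [P]. *)
Lemma thick_le_aisle A : thick_sub [set X | exists a, le_aisle A a X].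
Proof.
split; first split.
- by exists 0 => X i _ _; apply: ext0_zero.
- move=> X [a Xa]; split.
    by exists (a - 1) => Y i AY ai; apply/ext0_shr/Xa => //; lia.
  by exists (a + 1) => Y i AY ai; apply/ext0_shVr/Xa => //; lia.
- move=> X Y Z f g h T [a Xa] [b Yb]; exists (Num.max a b) => B i AB i_gt.
  apply: (@ext0_cone _ X Y) => //; first by exists f, g, h.
    by apply: Yb => //; lia.
  by apply: Xa => //; lia.
move=> X Y /summand_retract XY [a Ya]; exists a => Z i AZ ai.
exact/(ext0_retractr XY)/Ya.
Qed.

(** Used to bound the length of [S]-resolutions of objects of thick(P). *)
Lemma thick_coaisle A :
  thick_sub [set X | exists a : int, forall Y i, A Y -> a < i -> ext0 X Y i].
Proof.
split; first split.
- by exists 0 => X i _ _; apply: ext0_zerol.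
- move=> X [a Xa]; split.
    by exists (a + 1) => Y i AY ai; apply/ext0_shl/Xa => //; lia.
  by exists (a - 1) => Y i AY ai; apply/ext0_shVl/Xa => //; lia.
- move=> X Y Z f g h T [a Xa] [b Yb]; exists (Num.max (a + 1) b) => B i AB i_gt.
  apply: (@ext0_conel _ X Y) => //; first by exists f, g, h.
    by apply: Yb => //; lia.
  by apply: Xa => //; lia.
move=> X Y /summand_retract XY [a Ya]; exists a => Z i AZ ai.
exact/(ext0_retractl XY)/Ya.
Qed.

Lemma thick_subI A B : thick_sub A -> thick_sub B -> thick_sub (A `&` B).
Proof.
move=> [[A0 As Ac] Ar] [[B0 Bs Bc] Br]; split; first split=> //.
- by move=> X [/As [? ?] /Bs [? ?]].
- by move=> X Y Z f g h T [AX BX] [AY BY]; split; [apply: Ac T _ _|apply: Bc T _ _].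
by move=> X Y XY [AY BY]; split; [apply: Ar XY _|apply: Br XY _].
Qed.

Lemma triangulated_sub_tri A : triangulated_sub (tri A).
Proof.
split.
- by move=> B [[B0 _ _] _].
- move=> X AX; split=> B HB; have [_ Bs _] := HB.1;
  by have [? ?] := Bs X (AX B HB).
- move=> X Y Z f g h T AX AY B HB; have [_ _ Bc] := HB.1.
  exact: Bc T (AX B HB) (AY B HB).
Qed.

Lemma sub_tri A : A `<=` tri A.
Proof. exact: sub_smallest. Qed.

Lemma triangulated_sub_iso A X Y :
  triangulated_sub A -> iso X Y -> A X -> A Y.
Proof.
move=> [A0 _ Ac] XY AX.
have [f [g [h T]]] := tri3_iso (iso_refl _) (iso_refl X) XY (tri3_0id X).
exact: Ac T A0 AX.
Qed.

Lemma triangulated_sub_shift A n X :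
  triangulated_sub A -> A X -> A (shift n X).
Proof.
move=> [_ As _] AX; case: n => n; last by elim: n => [|n IHn] /=; apply As.
by elim: n => [|n IHn] //=; apply As.
Qed.

Lemma triangulated_sub_shiftV A n X :
  triangulated_sub A -> A (shift n X) -> A X.
Proof.
move=> tA /(triangulated_sub_shift (- n) tA).
exact: triangulated_sub_iso tA (shiftK n X).
Qed.

(** Wakamatsu's argument: in degree 1 maps from [S] to [Z] lift along the approximation; in higher
    degrees the neighbouring terms vanish. *)
Lemma le_aisle_approx S X Y Z (f : Mor X Y) (g : Mor Y Z) (h : Mor Z (sh X)) :
  presilting S -> right_approx S g -> triangle f g h ->
  le_aisle S 0 Z -> le_aisle S 0 X.
Proof.
move=> /presiltingP pS [SY appr] T Z0 B i SB i0.
have [->|i1] := eqVneq i 1.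
  apply: triangle_ext1 T _ _; last exact: pS.
  by move=> u; apply: appr.
apply: (@ext0_cocone _ _ Y Z); first by exists f, g, h.
  exact: pS.
by apply: Z0 => //; lia.
Qed.

(** The last of the [k + 1] successive right approximations splits by the
    vanishing hypothesis, so [W] has an [S]-resolution of length [k]. *)
Lemma approx_induction S (Wcls : set D) (Q : nat -> set D) (k : nat) W :
  subcategory S -> contravariantly_finite S ->
  Wcls `<=` le_aisle S 0 ->
  (forall X Y Z (f : Mor X Y) (g : Mor Y Z) (h : Mor Z (sh X)),
     Wcls Z -> right_approx S g -> triangle f g h -> Wcls X) ->
  S `<=` Q 0%N ->
  (forall n X Y Z, tri3 X Y Z -> Q n X -> S Y -> Q n.+1 Z) ->
  Wcls W -> (forall Y i, Wcls Y -> k%:Z < i -> ext0 W Y i) -> Q k W.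
Proof.
move=> addS cfS WS Wappr SQ QS; elim: k W => [|k IHk] W WW Wext;
  have [S1 [g [S1S appr]]] := cfS W; have [W1 [f [h T]]] := cocone_ex g;
  have WW1 := Wappr _ _ _ _ _ _ WW (conj S1S appr) T.
  apply: SQ; rewrite -addS; apply: add_retract (subset_add S1S).
  by apply: triangle_split T _; apply: (Wext _ 1 WW1).
have T3 : tri3 W1 S1 W by exists f, g, h.
apply: (QS _ _ _ _ T3 _ S1S); apply: IHk => // Y i WY ki.
apply: ext0_coconel T3 _ _; first by apply: WS => //; lia.
by apply: Wext => //; lia.
Qed.

End Aisles.

(** * Truncation for the t-structure of [P] *)

Section Truncation.
Variables (D : triangCatType) (P : set D).
Hypothesis tP : is_tstructure (Dle0 P) (Dge0 P).
Implicit Types (X Y Z W : D) (S : set D).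

Lemma aisle_hom0 q X Y :
  le_aisle P q X -> ge_aisle P (q + 1) Y -> hom0 X Y.
Proof.
case: tP => tP0 _ _ _ Xq Yq; apply/(hom0_shift q)/tP0.
  by apply/Dle0P; rewrite -(subrr q); apply: le_aisle_shift.
apply/shift_sub_Dge0; have -> : - -1 = q + 1 - q by lia.
exact: ge_aisle_shift.
Qed.

Lemma aisle_truncation q X :
  exists A B, [/\ le_aisle P q A, ge_aisle P (q + 1) B & tri3 A X B].
Proof.
case: tP => _ _ _ /(_ (shift q X)) [A [B [f [g [h [A0 B1 T]]]]]].
exists (shift (- q) A), (shift (- q) B); split.
- have {1}-> : q = 0 - (- q) by lia.
  exact/le_aisle_shift/Dle0P.
- have -> : q + 1 = - -1 - (- q) by lia.
  exact/ge_aisle_shift/shift_sub_Dge0.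
apply: tri3_iso (iso_refl _) (shiftK q X) (iso_refl _) _.
by apply: tri3_shift; exists f, g, h.
Qed.

(** The coaisle term [B] vanishes: its identity factors through [sh A], which has no maps to [B]. *)
Lemma trunc_le0_iso X : le_aisle P 0 X -> iso (trunc_le tP 0 X) X.
Proof.
rewrite /trunc_le /trunc_le0 /=.
case: cid => -[A B] /= [/Dle0P A0 /shift_sub_Dge0 B1 [f [g [h T]]]] X0.
apply: (@tri3_zero_iso _ _ _ B); first by exists f, g, h.
apply/is_zeroP; rewrite opprK in B1.
have [|v ->] := triangle_extend (u := idm B) (triangle_rotl T).
  by rewrite (aisle_hom0 X0 B1 g) compm0.
rewrite (@aisle_hom0 0 (sh A) B _ B1 v) ?comp0m// => Y i PY i0.
by apply/ext0_shr/A0 => //; lia.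
Qed.

(** On D^{≤0} the inner truncation is the identity up to isomorphism, so H^{[p,0]} is the single
    truncation σ^{≥p}. *)
Lemma coh_triangle p X : le_aisle P 0 X ->
  exists A, [/\ le_aisle P (p - 1) A, ge_aisle P p (coh tP p 0 X)
              & tri3 A X (coh tP p 0 X)].
Proof.
move=> /trunc_le0_iso; rewrite /coh; move: (trunc_le _ _ _) => Y YX.
rewrite /trunc_ge /trunc_ge1.
case: cid => -[A B] /= [/Dle0P A0 /shift_sub_Dge0 B1 T].
have K : p - 1 = 0 - (1 - p) by lia.
exists (shift (1 - p) A); split.
- by rewrite K; apply: le_aisle_shift.
- have {1}-> : p = - -1 - (1 - p) by lia.
  exact: ge_aisle_shift.
apply: tri3_iso (iso_refl _) _ (iso_refl _) (tri3_shift (1 - p) T).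
by apply: iso_trans YX; have := shiftK (p - 1) Y; rewrite opprB.
Qed.

End Truncation.

(** * The (d+1)-term subcategories: truncation to the extended heart, T(S) and Fac *)

Section TermSubcategories.
Variables (D : triangCatType) (P : set D) (d : nat).
Hypothesis tP : is_tstructure (Dle0 P) (Dge0 P).
Hypothesis P_presilting : presilting P.
Implicit Types (X Y Z W : D) (S M : set D).

Lemma Pterm_le n : Pterm P n `<=` le_aisle P 0.
Proof.
elim: n => [|n IHn] /=; first exact/presiltingP.
move=> Z [X [Y [f [g [h [/IHn X0 [Q PQ YQ] T]]]]]].
apply: (@le_aisle_mid _ _ _ X _ Y) => //; first by exists f, g, h.
apply: (le_aisle_iso (iso_sym YQ)) => B i PB i0; apply/ext0_shiftr.
by apply: (proj1 (presiltingP P) P_presilting Q PQ) => //; lia.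
Qed.

(** A layer [P[k]] raises the vanishing degree by [k], and [k] is at most [n]. *)
Lemma Pterm_ext0 n q X Y i :
  Pterm P n X -> le_aisle P q Y -> q + n%:Z < i -> ext0 X Y i.
Proof.
move=> + Yq; elim: n X => [|n IHn] X /=; first by move=> PX qi; apply: Yq => //; lia.
move=> [X' [X'' [f [g [h [nX' [Q PQ X''Q] T]]]]]] qi.
apply: (@ext0_midl _ X' _ X''); first by exists f, g, h.
  by apply: IHn => //; lia.
apply: (ext0_iso (iso_sym X''Q) (iso_refl Y)); apply/ext0_shiftl.
by apply: Yq => //; lia.
Qed.

Section Term.
Variable S : set D.
Hypothesis S_term : term_subcategory P d S.

Lemma term_le : S `<=` le_aisle P 0.
Proof. by case: S_term => _ _ SP X /SP; apply: Pterm_le. Qed.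

Lemma term_le_aisle q Y : le_aisle P q Y -> le_aisle S (q + d%:Z) Y.
Proof. by case: S_term => _ _ SP Yq X i /SP; move/Pterm_ext0; apply. Qed.

(** The fibre of the truncation map lies in D_P[d], hence in D_S, which lets membership in D_S pass
    between an object of [S] and its truncation. *)
Lemma term_coh X : S X ->
  exists A, [/\ le_aisle P (- d%:Z) A, le_aisle S 0 A
              & tri3 A X (coh tP (1 - d%:Z) 0 X)].
Proof.
move=> SX; have [A [Ad _ T]] := coh_triangle tP (1 - d%:Z) (term_le SX).
have {}Ad : le_aisle P (- d%:Z) A.
  by have -> : - d%:Z = 1 - d%:Z - 1 by lia.
exists A; split=> //.
by have := term_le_aisle Ad; rewrite addNr.
Qed.

Lemma coh_heart X : S X -> ext_heart P d (coh tP (1 - d%:Z) 0 X).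
Proof.
move=> SX; have [A [A0 C1 T]] := coh_triangle tP (1 - d%:Z) (term_le SX).
apply/ext_heartP; split=> //; apply: le_aisle_cone T (term_le SX) _.
by move=> Y i PY i1; apply: A0 => //; lia.
Qed.

Lemma ext_heart_add A : A `<=` ext_heart P d -> Defs.add A `<=` ext_heart P d.
Proof.
move=> AH X AX; apply/ext_heartP; split=> Y i PY i0;
  by apply: add_ext0r AX => Z /AH /ext_heartP [Z0 Z1]; first [exact: Z0 | exact: Z1].
Qed.

Lemma addH_heart : addH d tP S `<=` ext_heart P d.
Proof. by apply: ext_heart_add => _ [X SX <-]; apply: coh_heart. Qed.

Lemma ext_heart_zero : ext_heart P d zero_ob.
Proof. by apply/ext_heartP; split=> X i _ _; apply: ext0_zero. Qed.

Hypothesis S_cfin : contravariantly_finite S.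

Lemma presilting_coh : presilting S <-> addH d tP S `<=` le_aisle S 0.
Proof.
rewrite presiltingP; split=> [pS X SX|SH X SX].
  move=> Y i SY i0; apply: add_ext0r SX => _ [Z SZ <-].
  have [A [_ A0 T]] := term_coh SZ.
  apply: ext0_cone T _ _; first exact: pS.
  by apply: A0 => //; lia.
have [A [_ A0 T]] := term_coh SX.
apply: le_aisle_mid T A0 _; apply: SH; apply: subset_add.
by exists X.
Qed.

(** Each extriangle lowers by one the degree above which maps from [S] vanish; [Z d] starts at
    degree [d] because it lies in the heart. *)
Lemma Fac_torsion (d_gt0 : (0 < d)%N) :
  presilting S -> Fac P d d (addH d tP S) `<=` torsion P d S.
Proof.
move=> /presilting_coh MS Z0 [HZ0 [Z [X [<- ZX]]]].
apply/torsionP; split; first by case: (ZX 1%N d_gt0) => _ [].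
have step j : (j <= d)%N -> le_aisle S j%:Z (Z j) -> le_aisle S 0 (Z 0%N).
  elim: j => [|j IHj] jd Zj //; apply: IHj; first exact: ltnW.
  have [MX [_ _ _ T]] := ZX j.+1 jd.
  apply: le_aisle_cone T _ _.
    by move=> Y i SY ji; apply: MS => //; lia.
  by have -> : j%:Z + 1 = j.+1%:Z by lia.
apply: (step d) => //; rewrite -[d%:Z]add0r; apply: term_le_aisle.
by have [_ [/ext_heartP [] ]] := ZX d (introT andP (conj d_gt0 (leqnn d))).
Qed.

Lemma torsion_approx (S_le : le_aisle S 0 `<=` le_aisle P 0) Z0 :
  presilting S -> torsion P d S Z0 ->
  exists X Z1, [/\ addH d tP S X, torsion P d S Z1 & extriangle P d Z1 X Z0].
Proof.
move=> pS /torsionP [HZ0 SZ0].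
have [S1 [g [SS1 appr]]] := S_cfin Z0; have [Y [f [h T]]] := cocone_ex g.
have Y0 := le_aisle_approx pS (conj SS1 appr) T SZ0.
have [A [Ad A0 [a [c [b TA]]]]] := term_coh SS1.
have MC : addH d tP S (coh tP (1 - d%:Z) 0 S1) by apply: subset_add; exists S1.
have HC := addH_heart MC; have SC := proj1 presilting_coh pS _ MC.
(* [A] lies in D^{≤-d} and [Z0] in D^{≥1-d}, so [g] kills [A] and factors through the truncation. *)
have [|g' g'E] := triangle_extend (u := g) TA.
  apply: aisle_hom0 tP _ _ _ Ad _ (g ∘ a).
  by move/ext_heartP: HZ0 => [_]; rewrite addrC.
have [Z1 [f1 [h1 T1]]] := cocone_ex g'.
have T3 : tri3 Z1 (coh tP (1 - d%:Z) 0 S1) Z0 by exists f1, g', h1.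
(* Lifts along [g] push forward to lifts along [g'], so the cocone [Y] of [g] controls degree 1 of
   the cocone [Z1] of [g']. *)
have lift B : ext0 B Y 1 -> forall u : Mor B Z0, exists v, u = g' ∘ v.
  move=> BY u; have [v ->] := triangle_lift1 u T BY.
  by exists (c ∘ v); rewrite g'E mcompA.
have le1 (A' : set D) : le_aisle A' 0 Y -> le_aisle A' 0 (coh tP (1 - d%:Z) 0 S1) ->
    le_aisle A' 0 Z0 -> le_aisle A' 0 Z1.
  move=> A'Y A'C A'Z B i AB i0; have [->|i1] := eqVneq i 1.
    by apply: triangle_ext1 T1 (lift _ (A'Y _ _ _ _)) (A'C _ _ _ _).
  by apply: ext0_cocone T3 (A'C _ _ _ _) (A'Z _ _ _ _) => //; lia.
move/ext_heartP: (HZ0) => [Z00 Z01]; move/ext_heartP: (HC) => [C0 C1].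
have HZ1 : ext_heart P d Z1.
  apply/ext_heartP; split; first by apply: le1 => //; apply: S_le.
  by move=> B i PB i0; apply: ext0_cocone T3 (C1 _ _ _ _) (Z01 _ _ _ _) => //; lia.
exists (coh tP (1 - d%:Z) 0 S1), Z1; split=> //.
by apply/torsionP; split=> //; apply: le1.
Qed.

Lemma torsion_Fac (S_le : le_aisle S 0 `<=` le_aisle P 0) n :
  presilting S -> torsion P d S `<=` Fac P d n (addH d tP S).
Proof.
move=> pS; elim: n => [|n IHn] Z0 TZ0; have /torsionP [HZ0 _] := TZ0; split=> //.
  exists (fun=> Z0), (fun=> Z0); split=> // i.
  by rewrite leqn0 => /andP [/gtn_eqF ->].
have [X1 [Z1 [MX1 TZ1 E1]]] := torsion_approx S_le pS TZ0.
have [_ [Z [X [ZE ZX]]]] := IHn _ TZ1.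
(* The new extriangle goes in front; index 0 of the second sequence is a default value that is never
   read. *)
exists (fun i => if i is i'.+1 then Z i' else Z0).
exists (fun i => if i is i'.+2 then X i'.+1 else X1); split=> // -[|[|i]] //.
  by rewrite ZE.
by move=> /andP [_ i_le]; apply: (ZX i.+1).
Qed.

End Term.
End TermSubcategories.

(** * Recovering [S] from T(S), and generation of thick(P) *)

Section Silting.
Variables (D : triangCatType) (P : set D) (d : nat).
Hypothesis tP : is_tstructure (Dle0 P) (Dge0 P).
Hypothesis P_presilting : presilting P.
Implicit Types (X Y Z W : D) (S M : set D).

(** Objects of the aisle of [S] with a finite [S]-resolution lie in the aisle of
    [P], so [P] has no maps to them in positive degrees. An [S]-resolution of
    [P[d]] then consists of such objects and has length [d], and dimension
    shifting along it extends the vanishing to the whole aisle of [S]. *)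
Lemma silting_le_aisle S :
  term_subcategory P d S -> contravariantly_finite S -> silting (thick P) S ->
  le_aisle S 0 `<=` le_aisle P 0.
Proof.
move=> S_term S_cfin [_ addS pS triS].
pose fin : set D :=
  [set X | exists n : nat, forall Y i, le_aisle S 0 Y -> n%:Z < i -> ext0 X Y i].
have [coaisle_tri _] := thick_coaisle (le_aisle S 0).
have P_fin : thick P `<=` fin.
  rewrite -triS => X TX.
  have [|a Xa] := TX [set X | exists a : int,
      forall Y i, le_aisle S 0 Y -> a < i -> ext0 X Y i].
    by split=> // Y SY; exists 0 => Z i SZ; apply: SZ.
  by exists `|a|%N => Y i SY ai; apply: Xa => //; lia.
have fin_le X : le_aisle S 0 X -> fin X -> le_aisle P 0 X.
  move=> SX [n Xn].
  apply: (approx_induction (Wcls := le_aisle S 0) (Q := fun=> le_aisle P 0)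
    (k := n) addS S_cfin _ _ _ _ SX Xn) => //.
  - by move=> A B C f g h SC gS T; apply: le_aisle_approx pS gS T SC.
  - exact: term_le S_term.
  - move=> m A B C T PA SB; apply: le_aisle_cone T (term_le P_presilting S_term SB) _.
    by move=> Y i PY i1; apply: PA => //; lia.
move=> Y SY X i PX i0.
suff : ext0 (shift d%:Z X) Y (i + d%:Z).
  by move/ext0_shiftl; rewrite addrK.
have dX : (le_aisle S 0 `&` fin) (shift d%:Z X).
  split.
    have Xd : le_aisle P (0 - d%:Z) (shift d%:Z X).
      exact/le_aisle_shift/(proj1 (presiltingP P)).
    by have := term_le_aisle S_term Xd; rewrite subrK.
  have [|n Xn] := P_fin X; first by move=> B [_ PB]; apply: PB.
  by exists (n + d)%N => Z j SZ nj; apply/ext0_shiftl/Xn => //; lia.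
suff : forall Z j, le_aisle S 0 Z -> d%:Z < j -> ext0 (shift d%:Z X) Z j.
  by apply=> //; lia.
apply: (approx_induction (Wcls := le_aisle S 0 `&` fin)
  (Q := fun k W => forall Z j, le_aisle S 0 Z -> k%:Z < j -> ext0 W Z j)
  (k := d) addS S_cfin _ _ _ _ dX) => //.
- move=> A B C f g h [SC [n Cn]] gS T; split.
    exact: le_aisle_approx pS gS T SC.
  exists n => Z j SZ nj; apply: (@ext0_coconel _ A B C); first by exists f, g, h.
    by apply: SZ; [case: gS | lia].
  by apply: Cn => //; lia.
- by move=> B SB Z j SZ j0; apply: SZ.
- move=> n A B C T An SB Z j SZ nj; apply: ext0_conel T _ _.
    by apply: SZ => //; lia.
  by apply: An => //; lia.
(* The length [d] comes from here: [Z] lies in the aisle of [P], and shifting [X] by [d] moves its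
   vanishing range by [d]. *)
- move=> Z j [SZ Zfin] dj.
  apply/ext0_shiftl; apply: fin_le SZ Zfin _ _ PX _; lia.
Qed.

(** Truncate at degree -d: [A[1]] is still in both aisles, so the cone [B] is too. *)
Lemma le_aisle_truncation S X :
  term_subcategory P d S -> le_aisle S 0 X -> le_aisle P 0 X ->
  exists A B, [/\ le_aisle P (- d%:Z) A, torsion P d S B & tri3 A X B].
Proof.
move=> S_term SX PX; have [A [B [Ad Bd T]]] := aisle_truncation tP (- d%:Z) X.
exists A, B; split=> //; apply/torsionP; split.
  apply/ext_heartP; split; last by rewrite addrC.
  apply: le_aisle_cone T PX _.
  by move=> Y i PY i1; apply: Ad => //; lia.
apply: le_aisle_cone T SX _ => Y i SY i1.
by apply: (term_le_aisle S_term Ad) => //; lia.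
Qed.

Lemma le_aisle_torsion S A X B :
  term_subcategory P d S -> le_aisle P (- d%:Z) A -> torsion P d S B ->
  tri3 A X B -> le_aisle S 0 X.
Proof.
move=> S_term Ad /torsionP [_ SB] T; apply: le_aisle_mid T _ SB.
by have := term_le_aisle S_term Ad; rewrite addNr.
Qed.

(** The cocone [W] of an [S']-approximation of [X] lies in the common aisle, so the connecting map X
    → W[1] vanishes and [X] is a retract of an object of [S']. *)
Lemma le_aisle_subset S S' :
  subcategory S' -> contravariantly_finite S' -> presilting S ->
  presilting S' -> le_aisle S 0 = le_aisle S' 0 -> S `<=` S'.
Proof.
move=> addS' S'_cfin pS pS' SS' X SX.
have [S1 [g [S'S1 appr]]] := S'_cfin X; have [W [f [h T]]] := cocone_ex g.
have S'X : le_aisle S' 0 X by rewrite -SS'; apply: (proj1 (presiltingP S)).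
have := le_aisle_approx pS' (conj S'S1 appr) T S'X; rewrite -SS' => SW.
rewrite -addS'; apply: add_retract (subset_add S'S1).
by apply: triangle_split T _; apply: (SW _ 1 SX).
Qed.

Lemma torsion_inj S S' :
  term_subcategory P d S -> contravariantly_finite S -> silting (thick P) S ->
  term_subcategory P d S' -> contravariantly_finite S' ->
  silting (thick P) S' ->
  torsion P d S = torsion P d S' -> S = S'.
Proof.
move=> tS cS sS tS' cS' sS' TSS'.
have sub S1 S2 : term_subcategory P d S1 -> contravariantly_finite S1 ->
    silting (thick P) S1 -> term_subcategory P d S2 ->
    torsion P d S1 = torsion P d S2 -> le_aisle S1 0 `<=` le_aisle S2 0.
  move=> t1 c1 s1 t2 T12 X S1X; have PX := silting_le_aisle t1 c1 s1 S1X.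
  have [A [B [Ad TB T]]] := le_aisle_truncation t1 S1X PX.
  by apply: le_aisle_torsion t2 Ad _ T; rewrite -T12.
have SS' : le_aisle S 0 = le_aisle S' 0 by apply/seteqP; split; apply: sub.
case: sS => _ addS pS _; case: sS' => _ addS' pS' _.
by apply/seteqP; split; apply: le_aisle_subset.
Qed.

Lemma AIR_silting S : (0 < d)%N ->
  term_subcategory P d S -> contravariantly_finite S ->
  torsion P d S = Fac P d d (addH d tP S) -> silting (thick P) S.
Proof.
move=> d_gt0 S_term S_cfin TF; have [addS SK _] := S_term.
have pS : presilting S.
  apply/(presilting_coh tP P_presilting S_term) => X MX.
  have HX := addH_heart P_presilting S_term MX.
  suff : torsion P d S X by case/torsionP.
  rewrite TF; split=> //.
  (* The extriangle 0 → X → X, followed by zero extriangles. *)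
  exists (fun i => if i is 0%N then X else zero_ob).
  exists (fun i => if i is 1%N then X else zero_ob); split=> // -[|[|i]] // _.
    split=> //; split=> //; first exact: ext_heart_zero.
    exact: tri3_0id.
  split; first exact/add_zero/zero_obP.
  by split; do ?exact: ext_heart_zero; apply: tri3_0id.
pose Wcls : set D := le_aisle S 0 `&` le_aisle P 0.
have Wappr X Y Z (f : Mor X Y) (g : Mor Y Z) (h : Mor Z (sh X)) :
    Wcls Z -> right_approx S g -> triangle f g h -> Wcls X.
  move=> [SZ PZ] [SY appr] T; split.
    exact: le_aisle_approx pS (conj SY appr) T SZ.
  move=> Q i PQ i0; have [->|i1] := eqVneq i 1; last first.
    apply: (@ext0_cocone _ _ Y Z); first by exists f, g, h.
      by apply: (term_le P_presilting S_term SY) => //.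
    by apply: PZ => //; lia.
  (* In degree 1 every map [u] from [Q] in [P] to [Z] must lift along [g]; it is first lifted modulo
     the truncation [A] of [Z]. *)
  apply: triangle_ext1 T _ (term_le P_presilting S_term SY PQ _) => // u.
  have [A [B [Ad TB [a [b [c TAB]]]]]] := le_aisle_truncation S_term SZ PZ.
  have A0 : le_aisle S 0 A.
    by have := term_le_aisle S_term Ad; rewrite addNr.
  have [v vE] : exists v, b ∘ u = b ∘ (g ∘ v).
    (* [B] is in Fac_d(M), hence a quotient of the object [X' 1] of M with kernel in the heart, and
       [b ∘ u] lifts to [X' 1]. *)
    have := TB; rewrite TF => -[_ [Z' [X' [Z'0 /(_ 1%N d_gt0) [MX' [HZ1 _ _]]]]]].
    case=> q' [q [r Tq]]; rewrite Z'0 in q r Tq.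
    have [|w wE] := triangle_lift1 (b ∘ u) Tq.
      by move/ext_heartP: HZ1 => [+ _]; apply.
    (* The identity of [X' 1] is a sum of maps through truncations of objects [S'] of [S]. For each
       summand, the map from [Q] lifts to [S'], the map from [S'] to [B] lifts to [Z] as [A] is in
       the aisle of [S], and the approximation factors the latter through [g]. *)
    have [s sE] := proj1 (add_factors _ _) MX'.
    rewrite wE -(mcomp1m w) -sE.
    elim: s {sE} => [|x s [v vE]]; first by exists 0; rewrite big_nil comp0m !compm0.
    have [S' SS' S'x] := factoring_midP x.
    have [A' [A'd _ [a' [c' [b' TA']]]]] := term_coh tP P_presilting S_term SS'.
    rewrite S'x in c' b' TA'.
    have [|w' w'E] := triangle_lift1 (factoring_in x ∘ w) TA'.
      by apply: A'd => //; lia.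
    have [|t tE] := triangle_lift1 (q ∘ factoring_out x ∘ c') TAB.
      exact: A0.
    have [t' t'E] := appr _ t SS'.
    exists (t' ∘ w' + v).
    rewrite big_cons mcompDl !mcompDr -vE; congr (_ + _).
    by rewrite -mcompA w'E !mcompA tE t'E !mcompA.
  (* The error factors through [A], and Hom(Q, A) = 0 because [d] is positive. *)
  have [|u' u'E] := triangle_lift (u := u - g ∘ v) TAB.
    by rewrite compmB vE subrr.
  exists v; apply/eqP; rewrite -subr_eq0 u'E (_ : u' = 0) ?compm0//.
  by apply: (Ad Q 0) => //; lia.
have tT := triangulated_sub_tri S.
split=> //; apply/seteqP; split=> X.
  move=> TX B HB; apply: TX; split; first exact: HB.1.1.
  by move=> Y SY; apply: SK SY _ HB.
(* Both boundedness conditions hold on [P] and define thick classes, so they hold on thick(P). *)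
have th := thick_subI (thick_le_aisle (S `|` P)) (thick_coaisle Wcls).
case/(_ _ (conj th _)) => [Y PY|].
  split.
    exists d%:Z => Z i [SZ|PZ] di.
      apply: (term_le_aisle S_term (q := 0)) SZ _; last by rewrite add0r.
      exact: (proj1 (presiltingP P)).
    by apply: (proj1 (presiltingP P) P_presilting _ PY) => //; lia.
  by exists 0 => Z i [_ PZ]; apply: PZ.
move=> [a Xa] [b Xb].
(* [X[a]] lies in [Wcls], and its maps into [Wcls] vanish above degree [b + a]; the absolute value
   makes this a natural length. *)
apply: (triangulated_sub_shiftV (n := a) tT).
pose n := absz (b + a).
apply: (approx_induction (Wcls := Wcls) (Q := fun=> tri S) (k := n) addS S_cfin).
- by move=> Y [].
- exact: Wappr.
- exact: sub_tri.
- move=> m Y Y' Z [f [g [h T]]] TY /sub_tri TY'.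
  by have [_ _ tcone] := tT; apply: tcone T TY TY'.
- by split=> Y i AY i0; apply/ext0_shiftr/Xa; [left|lia|right|lia].
- by move=> Y i WY ni; apply/ext0_shiftl/Xb => //; lia.
Qed.

End Silting.

(** * Assembly of the bijection from the equality T(S) = Fac_d(M) *)

Theorem theorem2p8 (D : triangCatType) (P : set D)
    (P_subcat : subcategory P)
    (P_presilting : presilting P)
    (P_cfin : contravariantly_finite P)
    (P_bounded : exists m : int, m < 0 /\
       forall i : int, i < m -> hom_vanish P (shift_sub i P))
    (tP : is_tstructure (Dle0 P) (Dge0 P))
    (tP_nondeg : nondegenerate_tstructure (Dle0 P) (Dge0 P))
    (d : nat) (d_gt0 : (0 < d)%N) :
  set_bij
    [set S : set D | [/\ term_subcategory P d S, silting (thick P) S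
                       & contravariantly_finite S]]
    [set M : set D | AIR_tilting d tP M]
    (addH d tP).
Proof.
have torsionE S : term_subcategory P d S -> silting (thick P) S ->
    contravariantly_finite S -> torsion P d S = Fac P d d (addH d tP S).
  move=> S_term S_silt S_cfin; have [_ _ pS _] := S_silt.
  apply/seteqP; split.
    apply: torsion_Fac => //.
    exact: silting_le_aisle P_presilting _ S_term S_cfin S_silt.
  exact: Fac_torsion.
split.
- move=> S [S_term S_silt S_cfin]; split.
  + exact: add_idem.
  + exact: addH_heart.
  + by exists S; split=> //; apply: torsionE.
- move=> S S' /set_mem [tS sS cS] /set_mem [tS' sS' cS'] MM'.
  (* Equal images have equal Fac_d, hence the two torsion classes agree. *)
  by apply: (torsion_inj tP P_presilting tS) => //; rewrite !torsionE// MM'.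
(* A presentation witnessing that [M] is AIR tilting is itself the silting preimage. *)
- move=> M [_ _ [S [[S_term <-] S_cfin TF]]]; exists S => //; split=> //.
  exact: (AIR_silting P_presilting d_gt0 S_term S_cfin TF).
Qed.
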